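(* Let $D$ be a connection on the spinor bundle $S$ over the (pseudo-)Riemannian manifold $M$. The torsion $\mathcal T$ and the curvature $R$ of $D$ obey $$\hat D_{[\kappa}\mathcal T_{\mu\nu]}=\mathrm{ad}^C_{R_{[\kappa\mu}}\gamma_{\nu]},$$ $$\hat D_{[\kappa}(\mathrm{ad}^C_R\gamma)_{\mu\nu\rho]}=\tfrac12\,\mathrm{ad}^C_{R_{[\kappa\mu}}\mathcal T_{\nu\rho]},$$ $$D_{[\kappa}R_{\mu\nu]}=0,$$ where $(\mathrm{ad}^C_R\gamma)_{\mu\nu\rho}:=\mathrm{ad}^C_{R_{\mu\nu}}\gamma_\rho$.
   Context: $(M,g)$ is a (pseudo-)Riemannian spin manifold with Levi-Civita connection $\nabla$ (also on the spinor bundle $S$) and Clifford multiplication $\gamma:\mathfrak X(M)\to\Gamma\,\mathrm{End}(S)$, $\gamma(X)\gamma(Y)+\gamma(Y)\gamma(X)=-2g(X,Y)$; $\gamma_\mu=\gamma(e_\mu)$. $C$ is a fixed charge conjugation: a non-degenerate spin-invariant ($\nabla$-parallel) bilinear form on $S$, symmetric or skew. Square brackets around indices denote skew-symmetrization with weight one. For $\Phi\in\mathrm{End}(S)$, $\Phi^C$ is defined by $C(\Phi^C\eta,\xi)=C(\eta,\Phi\xi)$, and for $\Omega,\Phi\in\mathrm{End}(S)$, $\mathrm{ad}^C_\Omega\Phi:=\Omega\Phi+\Phi\Omega^C$. For a connection $D=\nabla+\mathcal A$ on $S$, $D^C:=\nabla-\mathcal A^C$. For an $\mathrm{End}(S)$-valued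 tensor $\Phi$ on $M$, $(\hat D_Z\Phi)(X)\xi:=D_Z(\Phi(X)\xi)-\Phi(\nabla_ZX)\xi-\Phi(X)D^C_Z\xi$, where $X$ stands for the tensor arguments of $\Phi$ and $\nabla_Z$ acts on them by the Leibniz rule. The torsion of $D$ is $\mathcal T(X,Y)=(\hat D_X\gamma)(Y)-(\hat D_Y\gamma)(X)$. The curvature is $R(X,Y)=[D_X,D_Y]-D_{[X,Y]}$, $R_{\mu\nu}=R(e_\mu,e_\nu)$. In the third identity $D$ denotes the connection on $\Omega^2(M)\otimes\Gamma\,\mathrm{End}(S)$ induced by $D$ and $\nabla$ (so $D_X\Omega=[D_X,\Omega]$ on $\Gamma\,\mathrm{End}(S)$); $\hat D_\kappa\mathcal T_{\mu\nu}=(\hat D_{e_\kappa}\mathcal T)(e_\mu,e_\nu)$, and similarly for the other tensors. *)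

(* Defs.v *)
From HB Require Import structures.
From mathcomp Require Import all_boot all_order all_algebra all_fingroup.
From mathcomp Require Import all_classical all_reals all_analysis.
From mathcomp Require Import complex.

Set Implicit Arguments.
Unset Strict Implicit.
Unset Printing Implicit Defensive.

Import Order.TTheory GRing.Theory Num.Theory numFieldNormedType.Exports.
Local Open Scope classical_set_scope.
Local Open Scope ring_scope.

(* Meant for open U. All directional derivatives, rather than only the
   partial ones, are required to exist up to order k. *)
Fixpoint Ck (R : realType) (n k : nat) (U : set 'rV[R]_n)
    (f : 'rV[R]_n -> R) {struct k} : Prop :=
  (forall x, U x -> {for x, continuous f}) /\
  if k is k'.+1 then
    forall v : 'rV[R]_n,
      (forall x, U x -> derivable f x v) /\ Ck k' U (fun x => 'D_v f x)
  else True.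

Section CkTheory.
Variables (R : realType) (n : nat).
Implicit Types (k : nat) (U : set 'rV[R]_n) (f g : 'rV[R]_n -> R).

Lemma Ck_ext k U f g : open U -> (forall x, U x -> f x = g x) ->
  Ck k U f -> Ck k U g.
Proof.
move=> oU; have nearfg f1 g1 : (forall x, U x -> f1 x = g1 x) ->
    forall x, U x -> {near x, f1 =1 g1}.
  by move=> fg x Ux; near=> y; apply: fg; near: y; exact: open_nbhs_nbhs.
have cext f1 g1 : (forall x, U x -> f1 x = g1 x) ->
    (forall x, U x -> {for x, continuous f1}) ->
    forall x, U x -> {for x, continuous g1}.
  move=> fg cf x Ux; rewrite /prop_for /continuous_at -(fg x Ux).
  exact: (cvg_trans (near_eq_cvg (nearfg _ _ fg x Ux)) (cf _ Ux)).
elim: k f g => [|k IH] f g fg [cf H]; split; try exact: (cext f g).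
  by [].
move=> v; have [df ckf] := H v; split=> [x Ux|].
  by apply: (@near_eq_derivable _ _ _ f); [exact: nearfg|exact: df].
by apply: (IH (fun x => 'D_v f x)) => // x Ux; apply: near_eq_derive; exact: (nearfg _ _ fg x Ux).
Unshelve. all: by end_near.
Qed.

Lemma Ck_cst k U (c : R) : open U -> Ck k U (fun=> c).
Proof.
move=> oU; elim: k c => [|k IH] c; split=> //; try by move=> x _; exact: cst_continuous.
move=> v; split=> [x _|]; first exact: derivable_cst.
by apply: (Ck_ext oU _ (IH 0)) => x _; exact/esym/derive_cst.
Qed.

Lemma CkD k U f g : open U -> Ck k U f -> Ck k U g -> Ck k U (fun x => f x + g x).
Proof.
move=> oU; elim: k f g => [|k IH] f g [cf Hf] [cg Hg]; split=> //;
  try by move=> x Ux; exact: (continuousD (cf x Ux) (cg x Ux)).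
move=> v; have [df ckf] := Hf v; have [dg ckg] := Hg v; split=> [x Ux|].
  by apply: derivableD; [exact: df|exact: dg].
apply: (Ck_ext oU _ (IH _ _ ckf ckg)) => x Ux.
by rewrite -deriveD; [|exact: df|exact: dg].
Qed.

Lemma CkW k U f : Ck k.+1 U f -> Ck k U f.
Proof.
elim: k f => [|k IH] f [cf H]; split=> // v.
by have [df ckf] := H v; split=> //; exact: IH.
Qed.

Lemma CkM k U f g : open U -> Ck k U f -> Ck k U g -> Ck k U (fun x => f x * g x).
Proof.
move=> oU; elim: k f g => [|k IH] f g ckf ckg;
  move: (ckf) (ckg) => [cf Hf] [cg Hg]; split=> //;
  try by move=> x Ux; exact: (continuousM (cf x Ux) (cg x Ux)).
move=> v; have [df ckdf] := Hf v; have [dg ckdg] := Hg v; split=> [x Ux|].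
  by apply: derivableM; [exact: df|exact: dg].
apply: (Ck_ext oU _ (CkD oU (IH _ _ (CkW ckf) ckdg) (IH _ _ (CkW ckg) ckdf))).
by move=> x Ux; exact/esym/(deriveM (df _ Ux) (dg _ Ux)).
Qed.

End CkTheory.

Record chart (R : realType) (n : nat) (T : topologicalType) := Chart {
  cdom : set T;
  ccod : set 'rV[R]_n;
  cmap : T -> 'rV[R]_n;
  cinv : 'rV[R]_n -> T;
  cdom_open : open cdom;
  ccod_open : open ccod;
  cmap_cod : forall p, cdom p -> ccod (cmap p);
  cinv_dom : forall x, ccod x -> cdom (cinv x);
  cmapK : forall p, cdom p -> cinv (cmap p) = p;
  cinvK : forall x, ccod x -> cmap (cinv x) = x;
  cmap_cont : forall p, cdom p -> {for p, continuous cmap};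
  cinv_cont : forall x, ccod x -> {for x, continuous cinv} }.

Record manifold (R : realType) (n : nat) := Manifold {
  mcarrier :> topologicalType;
  m_hausdorff : hausdorff_space mcarrier;
  m_second_countable : @second_countable mcarrier;
  atlas : set (chart R n mcarrier);
  atlas_cover : forall p, exists2 c, atlas c & cdom c p;
  atlas_compat : forall c d, atlas c -> atlas d -> forall (i : 'I_n) (k : nat),
    Ck k (ccod c `&` cinv c @^-1` cdom d) (fun x => cmap d (cinv c x) ord0 i) }.

Definition smooth_on (R : realType) (n : nat) (M : manifold R n)
    (U : set M) (f : M -> R) : Prop :=
  forall c, @atlas _ _ M c -> forall k : nat,
    Ck k (ccod c `&` cinv c @^-1` U) (fun x => f (cinv c x)).

Section SmoothOnTheory.
Variables (R : realType) (n : nat) (M : manifold R n).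
Implicit Types (U : set M) (f g : M -> R).

Lemma chart_region_open (c : chart R n M) U : open U ->
  open (ccod c `&` cinv c @^-1` U).
Proof.
move=> oU; rewrite openE => x [cx Ux]; rewrite /interior; apply: filterI.
  by apply: open_nbhs_nbhs; split=> //; exact: ccod_open.
by apply: (cinv_cont cx); exact: open_nbhs_nbhs.
Qed.

Lemma smooth_on_ext U f g : open U -> (forall p, U p -> f p = g p) ->
  smooth_on U f -> smooth_on U g.
Proof.
move=> oU fg sf c ac k; apply: Ck_ext (sf c ac k); first exact: chart_region_open.
by move=> x [_ Ux]; exact: fg.
Qed.

Lemma smooth_on_cst U (a : R) : open U -> smooth_on U (fun=> a).
Proof. by move=> oU c _ k; apply: Ck_cst; exact: chart_region_open. Qed.

Lemma smooth_onD U f g : open U -> smooth_on U f -> smooth_on U g ->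
  smooth_on U (fun p => f p + g p).
Proof.
by move=> oU sf sg c ac k;
  apply: CkD; [exact: chart_region_open|exact: sf|exact: sg].
Qed.

Lemma smooth_onM U f g : open U -> smooth_on U f -> smooth_on U g ->
  smooth_on U (fun p => f p * g p).
Proof.
by move=> oU sf sg c ac k;
  apply: CkM; [exact: chart_region_open|exact: sf|exact: sg].
Qed.

Lemma smooth_onN U f : open U -> smooth_on U f -> smooth_on U (fun p => - f p).
Proof.
move=> oU sf; apply: (smooth_on_ext oU _ (smooth_onM oU (smooth_on_cst (-1) oU) sf)).
by move=> p _; rewrite mulN1r.
Qed.

End SmoothOnTheory.

Inductive scalars := RealScalars | ComplexScalars.

Definition coef (R : realType) (k : scalars) : fieldType :=
  match k with RealScalars => R : fieldType | ComplexScalars => R[i] : fieldType end.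

Definition cre (R : realType) (k : scalars) : coef R k -> R :=
  match k with RealScalars => id | ComplexScalars => @complex.Re R end.

Definition cim (R : realType) (k : scalars) : coef R k -> R :=
  match k with RealScalars => fun=> 0 | ComplexScalars => @complex.Im R end.

(* a + i b; the imaginary part is dropped over the reals *)
Definition cmk (R : realType) (k : scalars) (a b : R) : coef R k :=
  match k with RealScalars => a | ComplexScalars => Complex a b end.

Arguments cre R k x : clear implicits.
Arguments cim R k x : clear implicits.
Arguments cmk R k a b : clear implicits.

Section CoefTheory.
Variables (R : realType) (k : scalars).
Implicit Types x y : coef R k.

Lemma creD x y : cre R k (x + y) = cre R k x + cre R k y.
Proof. by case: k x y => //= -[a b] [c d]. Qed.
Lemma cimD x y : cim R k (x + y) = cim R k x + cim R k y.
Proof. by case: k x y => [x y|[a b] [c d]] //=; rewrite addr0. Qed.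
Lemma creN x : cre R k (- x) = - cre R k x.
Proof. by case: k x => //= -[a b]. Qed.
Lemma cimN x : cim R k (- x) = - cim R k x.
Proof. by case: k x => [x|[a b]] //=; rewrite oppr0. Qed.
Lemma creM x y : cre R k (x * y) = cre R k x * cre R k y + - (cim R k x * cim R k y).
Proof. by case: k x y => [x y|[a b] [c d]] //=; rewrite mulr0 subr0. Qed.
Lemma cimM x y : cim R k (x * y) = cre R k x * cim R k y + cim R k x * cre R k y.
Proof. by case: k x y => [x y|[a b] [c d]] //=; rewrite mulr0 mul0r addr0. Qed.
Lemma cre_mk a b : cre R k (cmk R k a b) = a.
Proof. by case: k. Qed.
Lemma cim_mk a b : cim R k (cmk R k a b) = if k is RealScalars then 0 else b.
Proof. by case: k. Qed.

End CoefTheory.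

Definition csmooth_on (R : realType) (n : nat) (M : manifold R n) (k : scalars)
    (U : set M) (f : M -> coef R k) : Prop :=
  smooth_on U (fun p => cre R k (f p)) /\ smooth_on U (fun p => cim R k (f p)).

Section CSmoothTheory.
Variables (R : realType) (n : nat) (M : manifold R n) (k : scalars).
Implicit Types (U : set M) (f g : M -> coef R k).

Lemma csmooth_ext U f g : open U -> (forall p, U p -> f p = g p) ->
  csmooth_on U f -> csmooth_on U g.
Proof.
by move=> oU fg [sr si]; split; [apply: smooth_on_ext sr|apply: smooth_on_ext si];
  rewrite // => p /fg ->.
Qed.

Lemma csmooth_cst U (a : coef R k) : open U -> csmooth_on U (fun=> a).
Proof. by move=> oU; split; exact: smooth_on_cst. Qed.

Lemma csmoothD U f g : open U -> csmooth_on U f -> csmooth_on U g ->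
  csmooth_on U (fun p => f p + g p).
Proof.
move=> oU [fr fi] [gr gi]; split.
  by apply: (smooth_on_ext oU _ (smooth_onD oU fr gr)) => p _; rewrite creD.
by apply: (smooth_on_ext oU _ (smooth_onD oU fi gi)) => p _; rewrite cimD.
Qed.

Lemma csmoothN U f : open U -> csmooth_on U f -> csmooth_on U (fun p => - f p).
Proof.
move=> oU [fr fi]; split.
  by apply: (smooth_on_ext oU _ (smooth_onN oU fr)) => p _; rewrite creN.
by apply: (smooth_on_ext oU _ (smooth_onN oU fi)) => p _; rewrite cimN.
Qed.

Lemma csmoothM U f g : open U -> csmooth_on U f -> csmooth_on U g ->
  csmooth_on U (fun p => f p * g p).
Proof.
move=> oU [fr fi] [gr gi]; split.
  apply: (smooth_on_ext oU _ (smooth_onD oU (smooth_onM oU fr gr)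
    (smooth_onN oU (smooth_onM oU fi gi)))) => p _.
  by rewrite creM.
apply: (smooth_on_ext oU _ (smooth_onD oU (smooth_onM oU fr gi)
  (smooth_onM oU fi gr))) => p _.
by rewrite cimM.
Qed.

Lemma csmoothW U f : open U -> csmooth_on setT f -> csmooth_on U f.
Proof.
move=> oU [fr fi]; suff W (h : M -> R) : smooth_on setT h -> smooth_on U h.
  by split; exact: W.
move=> sh c ac j; have := sh c ac j.
have sub : ccod c `&` cinv c @^-1` U `<=` ccod c `&` cinv c @^-1` setT.
  by move=> x [].
move: sub; move: (_ `&` _) (_ `&` _) => A B AB.
elim: j (fun x => h (cinv c x)) => [|j IH] h1 [ch H].
  by split=> // x /AB; exact: ch.
split=> [x /AB|v]; first exact: ch.
by have [dh ckh] := H v; split=> [x /AB|]; [exact: dh|exact: IH].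
Qed.

End CSmoothTheory.

Record Csm (R : realType) (n : nat) (M : manifold R n) (k : scalars) := MkCsm {
  cfun :> M -> coef R k;
  cfunP : csmooth_on setT cfun }.

Section CsmAlgebra.
Variables (R : realType) (n : nat) (M : manifold R n) (k : scalars).
Local Notation A := (Csm M k).
Implicit Types f g h : A.

Lemma Csm_ext f g : (forall p, f p = g p) -> f = g.
Proof.
case: f g => [f Pf] [g Pg] /= fg; have {}fg : f = g by exact/funext.
by rewrite {f}fg in Pf *; congr MkCsm; exact: Prop_irrelevance.
Qed.

Definition ccst (a : coef R k) : A := MkCsm (csmooth_cst a openT).
Definition cadd f g : A := MkCsm (csmoothD openT (cfunP f) (cfunP g)).
Definition copp f : A := MkCsm (csmoothN openT (cfunP f)).
Definition cmul f g : A := MkCsm (csmoothM openT (cfunP f) (cfunP g)).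

Lemma caddA : associative cadd.
Proof. by move=> f g h; apply: Csm_ext => p /=; rewrite addrA. Qed.
Lemma caddC : commutative cadd.
Proof. by move=> f g; apply: Csm_ext => p /=; rewrite addrC. Qed.
Lemma cadd0 : left_id (ccst 0) cadd.
Proof. by move=> f; apply: Csm_ext => p /=; rewrite add0r. Qed.
Lemma caddN : left_inverse (ccst 0) copp cadd.
Proof. by move=> f; apply: Csm_ext => p /=; rewrite addNr. Qed.
Lemma cmulA : associative cmul.
Proof. by move=> f g h; apply: Csm_ext => p /=; rewrite mulrA. Qed.
Lemma cmulC : commutative cmul.
Proof. by move=> f g; apply: Csm_ext => p /=; rewrite mulrC. Qed.
Lemma cmul1 : left_id (ccst 1) cmul.
Proof. by move=> f; apply: Csm_ext => p /=; rewrite mul1r. Qed.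
Lemma cmulDl : left_distributive cmul cadd.
Proof. by move=> f g h; apply: Csm_ext => p /=; rewrite mulrDl. Qed.

HB.instance Definition _ := gen_eqMixin A.
HB.instance Definition _ := gen_choiceMixin A.
HB.instance Definition _ := GRing.isZmodule.Build A caddA caddC cadd0 caddN.
HB.instance Definition _ :=
  GRing.Zmodule_isComPzRing.Build A cmulA cmulC cmul1 cmulDl.

End CsmAlgebra.

Notation "'C^oo' M" := (Csm M RealScalars) (at level 10, M at level 8).

Section CsmReIm.
Variables (R : realType) (n : nat) (M : manifold R n) (k : scalars).

Lemma sre_subproof (f : Csm M k) :
  @csmooth_on _ _ M RealScalars setT (fun p => cre R k (f p)).
Proof. by split; [exact: (cfunP f).1|apply: smooth_on_cst openT]. Qed.
Definition sre (f : Csm M k) : C^oo M := MkCsm (sre_subproof f).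

Lemma sim_subproof (f : Csm M k) :
  @csmooth_on _ _ M RealScalars setT (fun p => cim R k (f p)).
Proof. by split; [exact: (cfunP f).2|apply: smooth_on_cst openT]. Qed.
Definition sim (f : Csm M k) : C^oo M := MkCsm (sim_subproof f).

Lemma smk_subproof (a b : C^oo M) : csmooth_on setT (fun p => cmk R k (a p) (b p)).
Proof.
split; first by apply: (smooth_on_ext openT _ (cfunP a).1) => p _; rewrite cre_mk.
case: k => [|]; first exact: (smooth_on_cst 0 openT).
exact: (cfunP b).1.
Qed.
Definition smk (a b : C^oo M) : Csm M k := MkCsm (smk_subproof a b).

Definition sreal (f : C^oo M) : Csm M k := smk f 0.

End CsmReIm.

(* The vector fields on M are the derivations of its algebra of smooth functions;
   a tensor field is a map on vector fields and sections that is multilinear over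
   smooth functions. *)
Record vfield (R : realType) (n : nat) (M : manifold R n) := VField {
  vact :> C^oo M -> C^oo M;
  vact_lin : forall (a : R) (f g : C^oo M),
    vact (@ccst _ _ M RealScalars a * f + g) =
    @ccst _ _ M RealScalars a * vact f + vact g;
  vact_leibniz : forall f g : C^oo M, vact (f * g) = vact f * g + f * vact g }.

Section VFieldTheory.
Variables (R : realType) (n : nat) (M : manifold R n).
Implicit Types (X Y Z : vfield M) (f g : C^oo M) (a : R).
Local Notation cst := (@ccst _ _ M RealScalars).

Lemma vfield_ext X Y : (forall f, X f = Y f) -> X = Y.
Proof.
case: X Y => [X P Q] [Y P' Q'] /= XY; have {}XY : X = Y by exact/funext.
by rewrite {X}XY in P Q *; congr VField; exact: Prop_irrelevance.
Qed.

Lemma vact0 X : X 0 = 0.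
Proof.
have := vact_leibniz X 0 0; rewrite !mulr0 mul0r addr0 => ->.
by [].
Qed.

Lemma vactD X f g : X (f + g) = X f + X g.
Proof. by have := vact_lin X 1 f g; rewrite !mul1r. Qed.

Lemma vactN X f : X (- f) = - X f.
Proof. by apply/eqP; rewrite -addr_eq0 -vactD addNr vact0. Qed.

Lemma vactZ X a f : X (cst a * f) = cst a * X f.
Proof. by have := vact_lin X a f 0; rewrite vact0 !addr0. Qed.

Lemma v0_lin a f g : (0 : C^oo M) = cst a * 0 + 0.
Proof. by rewrite mulr0 addr0. Qed.
Lemma v0_leibniz f g : (0 : C^oo M) = 0 * g + f * 0.
Proof. by rewrite mulr0 mul0r addr0. Qed.
Definition v0 : vfield M := @VField _ _ M (fun=> 0) v0_lin v0_leibniz.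

Lemma vadd_lin X Y a f g : X (cst a * f + g) + Y (cst a * f + g) =
  cst a * (X f + Y f) + (X g + Y g).
Proof. by rewrite !vact_lin mulrDr addrACA. Qed.
Lemma vadd_leibniz X Y f g :
  X (f * g) + Y (f * g) = (X f + Y f) * g + f * (X g + Y g).
Proof. by rewrite !vact_leibniz mulrDr mulrDl addrACA. Qed.
Definition vadd X Y : vfield M :=
  @VField _ _ M (fun f => X f + Y f) (vadd_lin X Y) (vadd_leibniz X Y).

Lemma vscale_lin (h : C^oo M) X a f g :
  h * X (cst a * f + g) = cst a * (h * X f) + h * X g.
Proof. by rewrite vact_lin mulrDr mulrCA. Qed.
Lemma vscale_leibniz (h : C^oo M) X f g :
  h * X (f * g) = (h * X f) * g + f * (h * X g).
Proof. by rewrite vact_leibniz mulrDr mulrA [h * (f * _)]mulrCA. Qed.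
Definition vscale (h : C^oo M) X : vfield M :=
  @VField _ _ M (fun f => h * X f) (vscale_lin h X) (vscale_leibniz h X).

Definition vopp X : vfield M := vscale (-1) X.

Lemma vaddA : associative vadd.
Proof. by move=> X Y Z; apply: vfield_ext => f /=; rewrite addrA. Qed.
Lemma vaddC : commutative vadd.
Proof. by move=> X Y; apply: vfield_ext => f /=; rewrite addrC. Qed.
Lemma vadd0 : left_id v0 vadd.
Proof. by move=> X; apply: vfield_ext => f /=; rewrite add0r. Qed.
Lemma vaddN : left_inverse v0 vopp vadd.
Proof. by move=> X; apply: vfield_ext => f /=; rewrite mulN1r addNr. Qed.

HB.instance Definition _ := gen_eqMixin (vfield M).
HB.instance Definition _ := gen_choiceMixin (vfield M).
HB.instance Definition _ := GRing.isZmodule.Build (vfield M) vaddA vaddC vadd0 vaddN.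

Lemma vscaleA (a b : C^oo M) X : vscale a (vscale b X) = vscale (a * b) X.
Proof. by apply: vfield_ext => f /=; rewrite mulrA. Qed.
Lemma vscale1 : left_id 1 vscale.
Proof. by move=> X; apply: vfield_ext => f /=; rewrite mul1r. Qed.
Lemma vscaleDr : right_distributive vscale +%R.
Proof. by move=> a X Y; apply: vfield_ext => f /=; rewrite mulrDr. Qed.
Lemma vscaleDl X : {morph vscale^~ X : a b / a + b}.
Proof. by move=> a b; apply: vfield_ext => f /=; rewrite mulrDl. Qed.

HB.instance Definition _ := GRing.Zmodule_isLmodule.Build (C^oo M) (vfield M)
  vscaleA vscale1 vscaleDr vscaleDl.

Lemma vbracket_lin X Y a f g :
  X (Y (cst a * f + g)) - Y (X (cst a * f + g)) =
  cst a * (X (Y f) - Y (X f)) + (X (Y g) - Y (X g)).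
Proof. by rewrite !vact_lin opprD addrACA mulrBr. Qed.
Lemma vbracket_aux (V : zmodType) (a b c d a' d' : V) :
  a + b + (c + d) - (a' + c + (b + d')) = a - a' + (d - d').
Proof.
apply/eqP; rewrite subr_eq [eqbRHS]addrACA [a - a' + _]addrA subrK.
by rewrite [b + d']addrC [d - d' + _]addrA subrK [d + b]addrC addrACA.
Qed.
Lemma vbracket_leibniz X Y f g :
  X (Y (f * g)) - Y (X (f * g)) =
  (X (Y f) - Y (X f)) * g + f * (X (Y g) - Y (X g)).
Proof.
by rewrite !(vact_leibniz, vactD) vbracket_aux mulrBl mulrBr.
Qed.
Definition vbracket X Y : vfield M :=
  @VField _ _ M (fun f => X (Y f) - Y (X f)) (vbracket_lin X Y) (vbracket_leibniz X Y).

End VFieldTheory.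

(* complex-linear extension of the derivation X to k-valued functions *)
Definition vactK (R : realType) (n : nat) (M : manifold R n) (k : scalars)
    (X : vfield M) (f : Csm M k) : Csm M k := smk k (X (sre f)) (X (sim f)).

(* tmap is junk outside the fibres over tdom *)
Record triv (R : realType) (n : nat) (M : manifold R n) (k : scalars) (r : nat)
    (E : M -> lmodType (coef R k)) := Triv {
  tdom : set M;
  tmap : forall p, E p -> 'cV[coef R k]_r }.

Record vbundle (R : realType) (n : nat) (M : manifold R n) (k : scalars)
    (r : nat) := VBundle {
  fibre : M -> lmodType (coef R k);
  trivs : set (triv r fibre);
  trivs_open : forall t, trivs t -> open (tdom t);
  trivs_cover : forall p, exists2 t, trivs t & tdom t p;
  trivs_lin : forall t, trivs t -> forall p, tdom t p -> linear (@tmap _ _ _ _ _ _ t p);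
  trivs_bij : forall t, trivs t -> forall p, tdom t p -> bijective (@tmap _ _ _ _ _ _ t p);
  trivs_compat : forall s t, trivs s -> trivs t ->
    exists2 h : M -> 'M[coef R k]_r,
      forall i j, csmooth_on (tdom s `&` tdom t) (fun p => h p i j) &
      forall p, tdom s p -> tdom t p -> forall v : fibre p,
        tmap t v = h p *m tmap s v }.

Record Gam (R : realType) (n : nat) (M : manifold R n) (k : scalars) (r : nat)
    (S : vbundle M k r) := MkGam {
  gsec :> forall p, fibre S p;
  gsecP : forall t, trivs t -> forall i : 'I_r,
    csmooth_on (tdom t) (fun p => tmap t (gsec p) i ord0) }.

Section GamTheory.
Variables (R : realType) (n : nat) (M : manifold R n) (k : scalars) (r : nat).
Variable S : vbundle M k r.
Implicit Types (s t : Gam S) (f g : Csm M k).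

Lemma Gam_ext s t : (forall p, s p = t p) -> s = t.
Proof.
case: s t => [s Ps] [t Pt] /= st.
have {}st : s = t by apply: functional_extensionality_dep.
by rewrite {s}st in Ps *; congr MkGam; exact: Prop_irrelevance.
Qed.

Lemma gadd_subproof s t u : trivs u -> forall i : 'I_r,
  csmooth_on (tdom u) (fun p => tmap u (s p + t p) i ord0).
Proof.
move=> Tu i; apply: (csmooth_ext (trivs_open Tu) _
  (csmoothD (trivs_open Tu) (gsecP s Tu i) (gsecP t Tu i))) => p up.
have := trivs_lin Tu up 1 (s p) (t p); rewrite !scale1r => ->.
by rewrite mxE.
Qed.
Definition gadd s t : Gam S := MkGam (@gadd_subproof s t).

Lemma gscale_subproof f s u : trivs u -> forall i : 'I_r,
  csmooth_on (tdom u) (fun p => tmap u (f p *: s p) i ord0).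
Proof.
move=> Tu i; have oU := trivs_open Tu.
apply: (csmooth_ext oU _ (csmoothM oU (csmoothW oU (cfunP f)) (gsecP s Tu i))).
move=> p up; have l := trivs_lin Tu up.
have l0 : tmap u (0 : fibre S p) = 0.
  by apply: (addrI (tmap u (0 : fibre S p)));
    have := l 1 0 0; rewrite !scale1r !addr0 => <-.
by have := l (f p) (s p) 0; rewrite l0 !addr0 => ->; rewrite mxE.
Qed.
Definition gscale f s : Gam S := MkGam (@gscale_subproof f s).

Lemma g0_subproof u : trivs u -> forall i : 'I_r,
  csmooth_on (tdom u) (fun p => tmap u (0 : fibre S p) i ord0).
Proof.
move=> Tu i; have oU := trivs_open Tu.
apply: (csmooth_ext oU _ (csmooth_cst 0 oU)) => p up.
have l := trivs_lin Tu up.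
have -> : tmap u (0 : fibre S p) = 0.
  by apply: (addrI (tmap u (0 : fibre S p)));
    have := l 1 0 0; rewrite !scale1r !addr0 => <-.
by rewrite mxE.
Qed.
Definition g0 : Gam S := MkGam g0_subproof.
Definition gopp s : Gam S := gscale (-1) s.

Lemma gaddA : associative gadd.
Proof. by move=> s t u; apply: Gam_ext => p /=; rewrite addrA. Qed.
Lemma gaddC : commutative gadd.
Proof. by move=> s t; apply: Gam_ext => p /=; rewrite addrC. Qed.
Lemma gadd0 : left_id g0 gadd.
Proof. by move=> s; apply: Gam_ext => p /=; rewrite add0r. Qed.
Lemma gaddN : left_inverse g0 gopp gadd.
Proof. by move=> s; apply: Gam_ext => p /=; rewrite scaleN1r addNr. Qed.

HB.instance Definition _ := gen_eqMixin (Gam S).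
HB.instance Definition _ := gen_choiceMixin (Gam S).
HB.instance Definition _ := GRing.isZmodule.Build (Gam S) gaddA gaddC gadd0 gaddN.

Lemma gscaleA f g s : gscale f (gscale g s) = gscale (f * g) s.
Proof. by apply: Gam_ext => p /=; rewrite scalerA. Qed.
Lemma gscale1 : left_id 1 gscale.
Proof. by move=> s; apply: Gam_ext => p /=; rewrite scale1r. Qed.
Lemma gscaleDr : right_distributive gscale +%R.
Proof. by move=> f s t; apply: Gam_ext => p /=; rewrite scalerDr. Qed.
Lemma gscaleDl s : {morph gscale^~ s : f g / f + g}.
Proof. by move=> f g; apply: Gam_ext => p /=; rewrite scalerDl. Qed.

HB.instance Definition _ := GRing.Zmodule_isLmodule.Build (Csm M k) (Gam S)
  gscaleA gscale1 gscaleDr gscaleDl.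

End GamTheory.

Definition form_bilinear (A : comPzRingType) (E : lmodType A) (b : E -> E -> A) : Prop :=
  (forall x, scalar (b x)) /\ (forall y, scalar (b^~ y)).

(* For E the module of sections of a vector bundle V this says that b induces
   an isomorphism from V onto its dual; injectivity is the condition in the
   first argument, which is enough for symmetric and skew forms. *)
Definition form_nondegenerate (A : comPzRingType) (E : lmodType A)
    (b : E -> E -> A) : Prop :=
  (forall x, (forall y, b x y = 0) -> x = 0) /\
  (forall a : E -> A, scalar a -> exists x, forall y, b x y = a y).

Record metric (R : realType) (n : nat) (M : manifold R n) := Metric {
  gform :> vfield M -> vfield M -> C^oo M;
  gform_bilinear : form_bilinear gform;
  gform_sym : forall X Y : vfield M, gform X Y = gform Y X;
  gform_nondeg : form_nondegenerate gform }.

Record is_levi_civita (R : realType) (n : nat) (M : manifold R n) (g : metric M)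
    (nabla : vfield M -> vfield M -> vfield M) : Prop := IsLeviCivita {
  lc_linl : forall (f : C^oo M) (X Y Z : vfield M),
    nabla (f *: X + Y) Z = f *: nabla X Z + nabla Y Z;
  lc_addr : forall X Y Z : vfield M, nabla X (Y + Z) = nabla X Y + nabla X Z;
  lc_leibniz : forall (X : vfield M) (f : C^oo M) (Y : vfield M),
    nabla X (f *: Y) = X f *: Y + f *: nabla X Y;
  lc_torsion_free : forall X Y : vfield M, nabla X Y - nabla Y X = vbracket X Y;
  lc_metric : forall X Y Z : vfield M, X (g Y Z) = g (nabla X Y) Z + g Y (nabla X Z) }.

Record is_connection (R : realType) (n : nat) (M : manifold R n) (k : scalars)
    (r : nat) (S : vbundle M k r) (D : vfield M -> Gam S -> Gam S) : Prop :=
    IsConnection {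
  conn_linl : forall (f : C^oo M) (X Y : vfield M) (xi : Gam S),
    D (f *: X + Y) xi = sreal k f *: D X xi + D Y xi;
  conn_addr : forall (X : vfield M) (xi eta : Gam S), D X (xi + eta) = D X xi + D X eta;
  conn_leibniz : forall (X : vfield M) (f : Csm M k) (xi : Gam S),
    D X (f *: xi) = vactK X f *: xi + f *: D X xi }.

(* diagonal entries of the standard form with t minus signs *)
Definition esign (R : realType) (t : nat) (n : nat) (i : 'I_n) : R :=
  if (i < t)%N then -1 else 1.

Definition equad (R : realType) (t : nat) (n : nat) (v : 'rV[R]_n) : R :=
  \sum_(i < n) esign R t i * v ord0 i ^+ 2.

Definition clmx (R : realType) (k : scalars) (n r : nat)
    (G : 'I_n -> 'M[coef R k]_r) (v : 'rV[R]_n) : 'M[coef R k]_r :=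
  \sum_(i < n) cmk R k (v ord0 i) 0 *: G i.

(* Spin(n-t,t), consisting of the products of an even number of unit vectors,
   in the Clifford module given by the gamma matrices G. It acts faithfully on
   every nonzero Clifford module, so that no information is lost by working
   with its image in GL(r). *)
Definition spin_mx (R : realType) (k : scalars) (t n r : nat)
    (G : 'I_n -> 'M[coef R k]_r) : set 'M[coef R k]_r :=
  [set h | exists s : seq 'rV[R]_n,
    [/\ ~~ odd (size s),
        forall v, v \in s -> equad t v = 1 \/ equad t v = -1 &
        h = foldr (fun v a => clmx G v *m a) 1%:M s]].

(* A spin structure together with the spinor bundle associated with the
   Clifford module given by sgamma: the trivializations of the bundle are those
   defined by the local sections of the spin structure. So they are related by
   elements of the spin group, and Clifford multiplication is given in them by
   the constant matrices sgamma, X having components x in the underlying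
   orthonormal frame. *)
Record spinor_bundle (R : realType) (n : nat) (M : manifold R n) (g : metric M)
    (k : scalars) := SpinorBundle {
  srank : nat;
  srank_gt0 : (0 < srank)%N;
  sbundle :> vbundle M k srank;
  sindex : nat;
  sgamma : 'I_n -> 'M[coef R k]_srank;
  sgamma_clifford : forall i j : 'I_n,
    sgamma i *m sgamma j + sgamma j *m sgamma i =
    if i == j then (cmk R k (- 2 * esign R sindex i) 0)%:M else 0;
  cliff : vfield M -> {linear Gam sbundle -> Gam sbundle};
  cliff_linl : forall (f : C^oo M) (X Y : vfield M) (xi : Gam sbundle),
    cliff (f *: X + Y) xi = sreal k f *: cliff X xi + cliff Y xi;
  cliff_clifford : forall (X Y : vfield M) (xi : Gam sbundle),
    cliff X (cliff Y xi) + cliff Y (cliff X xi) = sreal k (- 2 * g X Y) *: xi;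
  spin_frames : forall s t, trivs s -> trivs t ->
    forall p, tdom s p -> tdom t p ->
      exists2 h, spin_mx sindex sgamma h &
        forall v : fibre sbundle p, tmap t v = h *m tmap s v;
  cliff_frames : forall t, trivs t -> forall p, tdom t p -> forall X : vfield M,
    exists x : 'rV[R]_n, forall xi : Gam sbundle,
      tmap t (cliff X xi p) = clmx sgamma x *m tmap t (xi p) }.

(* The lift of the Levi-Civita connection: Clifford multiplication is parallel
   and, on sections that are locally constant in a spin frame, nablaS acts by
   an element of the Lie algebra spin(n-t,t), spanned by the products of two
   different gamma matrices. *)
Record is_spin_connection (R : realType) (n : nat) (M : manifold R n)
    (g : metric M) (nabla : vfield M -> vfield M -> vfield M) (k : scalars)
    (S : spinor_bundle g k) (nablaS : vfield M -> Gam S -> Gam S) : Prop :=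
    IsSpinConnection {
  spin_conn : is_connection nablaS;
  spin_conn_cliff : forall (X Y : vfield M) (xi : Gam S),
    nablaS X (cliff S Y xi) = cliff S (nabla X Y) xi + cliff S Y (nablaS X xi);
  spin_conn_frames : forall t, trivs t -> forall p, tdom t p -> forall X : vfield M,
    exists a : 'M[R]_n, forall xi : Gam S,
      (\forall q \near p, tmap t (xi q) = tmap t (xi p)) ->
      tmap t (nablaS X xi p) =
      (\sum_(i < n) \sum_(j < n | (i < j)%N)
        cmk R k (a i j) 0 *: (sgamma S i *m sgamma S j)) *m tmap t (xi p) }.

(* Spin-invariance is stated for the Lie algebra. *)
Record is_charge_conjugation (R : realType) (n : nat) (M : manifold R n)
    (g : metric M) (k : scalars) (S : spinor_bundle g k)
    (nablaS : vfield M -> Gam S -> Gam S) (C : Gam S -> Gam S -> Csm M k) : Prop :=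
    IsChargeConjugation {
  cc_bilinear : form_bilinear C;
  cc_nondeg : form_nondegenerate C;
  cc_sym : (forall eta xi : Gam S, C eta xi = C xi eta) \/
           (forall eta xi : Gam S, C eta xi = - C xi eta);
  cc_spin : forall (X Y : vfield M) (eta xi : Gam S),
    C (cliff S X (cliff S Y eta) - cliff S Y (cliff S X eta)) xi +
    C eta (cliff S X (cliff S Y xi) - cliff S Y (cliff S X xi)) = 0;
  cc_parallel : forall (X : vfield M) (eta xi : Gam S),
    vactK X (C eta xi) = C (nablaS X eta) xi + C eta (nablaS X xi) }.

(* A section of End(S) is used through its action on sections of S, and an
   End(S)-valued tensor with m arguments is evaluated on m vector fields. *)
Definition endo (R : realType) (n : nat) (M : manifold R n) (k : scalars)
  (r : nat) (S : vbundle M k r) := Gam S -> Gam S.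

Definition etensor (R : realType) (n : nat) (M : manifold R n) (k : scalars)
  (r : nat) (S : vbundle M k r) (m : nat) := ('I_m -> vfield M) -> endo S.

Section Torsion.
Variables (R : realType) (n : nat) (M : manifold R n) (k : scalars) (r : nat).
Variable S : vbundle M k r.
Implicit Types (X Y Z : vfield M) (Phi Omega : endo S) (xi eta : Gam S).

(* weight one *)
Definition alt (m : nat) (F : etensor S m) : etensor S m := fun Xs xi =>
  ccst M (m`!%:R^-1 : coef R k) *:
    \sum_(s : 'S_m) (-1) ^+ s *: F (fun i => Xs (s i)) xi.

(* (Z, X_1, ..., X_m) |-> (F_Z)(X_1, ..., X_m) *)
Definition uncurry_tensor (m : nat) (F : vfield M -> etensor S m) : etensor S m.+1 :=
  fun Xs => F (Xs ord0) (fun i => Xs (lift ord0 i)).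

Definition curvature (D : vfield M -> endo S) : etensor S 2 := fun Xs xi =>
  let X := Xs ord0 in let Y := Xs ord_max in
  D X (D Y xi) - D Y (D X xi) - D (vbracket X Y) xi.

(* the sum of the terms Phi(X_1, ..., nabla_Z X_i, ..., X_m) *)
Definition leibniz_sum (nabla : vfield M -> vfield M -> vfield M) (m : nat)
    (Z : vfield M) (Phi : etensor S m) : etensor S m := fun Xs xi =>
  \sum_(i < m) Phi (fun j => if j == i then nabla Z (Xs i) else Xs j) xi.

(* covariant derivative of End(S)-valued tensors induced by D and nabla *)
Definition covD (nabla : vfield M -> vfield M -> vfield M)
    (D : vfield M -> endo S) (Z : vfield M) (m : nat) (Phi : etensor S m) :
    etensor S m := fun Xs xi =>
  D Z (Phi Xs xi) - Phi Xs (D Z xi) - leibniz_sum nabla Z Phi Xs xi.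

Variable C : Gam S -> Gam S -> Csm M k.

(* If C is non-degenerate and Phi is linear over smooth functions, then there
   is exactly one such zeta. *)
Definition cadj (Phi : endo S) : endo S := fun eta =>
  xget 0 [set zeta : Gam S | forall xi, C zeta xi = C eta (Phi xi)].

Definition adC (Omega Phi : endo S) : endo S := fun xi =>
  Omega (Phi xi) + Phi (cadj Omega xi).

Variables (nabla : vfield M -> vfield M -> vfield M) (nablaS D : vfield M -> endo S).

Definition connC : vfield M -> endo S := fun X xi =>
  nablaS X xi - cadj (fun eta => D X eta - nablaS X eta) xi.

Definition hatD (Z : vfield M) (m : nat) (Phi : etensor S m) : etensor S m :=
  fun Xs xi =>
  D Z (Phi Xs xi) - leibniz_sum nabla Z Phi Xs xi - Phi Xs (connC Z xi).

Variable gam : vfield M -> endo S.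

Definition gam_tensor : etensor S 1 := fun Xs => gam (Xs ord0).

Definition torsion : etensor S 2 := fun Xs xi =>
  hatD (Xs ord0) gam_tensor (fun=> Xs ord_max) xi -
  hatD (Xs ord_max) gam_tensor (fun=> Xs ord0) xi.

(* (X_1, ..., X_{m+2}) |-> ad^C_{R(X_1,X_2)} Phi(X_3, ..., X_{m+2}) *)
Definition adCR (m : nat) (Phi : etensor S m) : etensor S m.+2 := fun Xs =>
  adC (curvature D (fun i : 'I_2 => Xs (lshift m i)))
      (Phi (fun i => Xs (rshift 2 i))).

End Torsion.

(* Main.v *)
Require Import Defs.
From HB Require Import structures.
From mathcomp Require Import all_boot all_order all_algebra all_fingroup.
From mathcomp Require Import all_classical all_reals all_analysis.
From mathcomp Require Import complex.

Set Implicit Arguments.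
Unset Strict Implicit.
Unset Printing Implicit Defensive.

Import Order.TTheory GRing.Theory Num.Theory numFieldNormedType.Exports.
Local Open Scope ring_scope.

(* The connection D^C is dual to D with respect to the form C, so that its
   curvature is - R^C. Hence ad^C_R Phi = R Phi - Phi R', where R' is the curvature
   of D^C, and hat D is the connection induced by D and D^C on endomorphisms. As
   nabla is torsion free and the tensors are skew in two arguments, the derivatives
   of the arguments turn into brackets under cyclic summation; the first and the
   third identity then follow from the Jacobi identity. For the second one, the
   Leibniz rule splits hat D_W (ad^C_R gamma)(X, Y, Z) into terms with D R and
   D^C R', which vanish under alternation by the third identity, and into
   ad^C_{R(X,Y)} (hat D_W gamma)(Z), which alternates to half of ad^C_R T. *)

(* Proves identities of abelian groups. Subterms are selected by syntactic
   matching, since rewriting modulo conversion would unfold curvatures and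
   torsions into sums. *)
Ltac zmod_cancel :=
  apply/eqP; rewrite -subr_eq0; apply/eqP; rewrite -[LHS]addr0;
  repeat match goal with
  | |- context [- (?x + ?y)] => rewrite (opprD x y)
  | |- context [- 0] => rewrite oppr0
  | |- context [0 + ?x] => rewrite (add0r x)
  | |- context [- - ?x] => rewrite (opprK x)
  | |- context [?x + ?y + ?z] => rewrite -(addrA x y z)
  end;
  repeat match goal with
  | |- 0 = 0 => reflexivity
  | |- - ?x + _ = 0 =>
    repeat (lazymatch goal with
            | |- - x + (x + _) = 0 => fail
            | _ => rewrite (addrCA _ x) end); rewrite addKr
  | |- ?x + _ = 0 =>
    repeat (lazymatch goal with
            | |- x + (- x + _) = 0 => fail
            | _ => rewrite (addrCA _ (- x)) end); rewrite addNKr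
  end.

(** * Bianchi-type identities for biadditive operators on abelian groups *)

Section CyclicIdentities.
Variables (V E : zmodType) (br nabla : V -> V -> V).
Hypothesis nabla_br : forall X Y, nabla X Y - nabla Y X = br X Y.
Hypothesis brB : forall X, zmod_morphism (br^~ X).
Hypothesis jacobi : forall X Y Z, br (br X Y) Z + br (br Y Z) X + br (br Z X) Y = 0.

(** Vector fields and sections enter only as abelian groups: the identities below compare sums of
    composed operators and never multiply by a function. *)
Definition biadditive (U W : zmodType) (D : V -> U -> W) :=
  (forall X, zmod_morphism (D X)) /\ (forall x, zmod_morphism (D^~ x)).

Definition curv (D : V -> E -> E) X Y x := D X (D Y x) - D Y (D X x) - D (br X Y) x.

Definition nabla_curv (D : V -> E -> E) Z X Y x :=
  D Z (curv D X Y x) - curv D X Y (D Z x) -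
  (curv D (nabla Z X) Y x + curv D X (nabla Z Y) x).

Lemma zmod_morphism_simpl (U W : zmodType) (f : U -> W) : zmod_morphism f ->
  (f 0 = 0) * (forall x, f (- x) = - f x) * (forall x y, f (x + y) = f x + f y).
Proof.
move=> fB; pose F : {additive U -> W} := HB.pack f (GRing.isZmodMorphism.Build U W f fB).
by split; [split; [exact: (raddf0 F)|exact: (raddfN F)]|exact: (raddfD F)].
Qed.

Lemma br_skew X Y : br X Y = - br Y X.
Proof. by rewrite -!nabla_br opprB. Qed.

(** By skewness the six terms pair up as H (nabla Z X) Y - H (nabla X Z) Y and its cyclic images,
    and each difference of derivatives is a bracket. *)
Lemma cyclic_nabla (H : V -> V -> E) :
  (forall X Y, H X Y = - H Y X) -> (forall Y, zmod_morphism (H^~ Y)) ->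
  forall X Y Z,
  (H (nabla Z X) Y + H X (nabla Z Y)) + (H (nabla X Y) Z + H Y (nabla X Z)) +
  (H (nabla Y Z) X + H Z (nabla Y X)) =
  H (br Z X) Y + H (br X Y) Z + H (br Y Z) X.
Proof.
move=> Hskew HB X Y Z; rewrite -!nabla_br !(HB _).
by rewrite (Hskew X) (Hskew Y) (Hskew Z); zmod_cancel.
Qed.

Section Connection.
Variable D : V -> E -> E.
Hypothesis Dadd : biadditive D.

Let Dr X := zmod_morphism_simpl (Dadd.1 X).
Let Dl x := zmod_morphism_simpl (Dadd.2 x).
Let brl X := zmod_morphism_simpl (brB X).

Lemma curv_skew X Y x : curv D X Y x = - curv D Y X x.
Proof. by rewrite /curv (br_skew X) (Dl _); zmod_cancel. Qed.

Lemma curv_vB Y x : zmod_morphism (fun X => curv D X Y x).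
Proof. by move=> A B; rewrite /curv !(Dl, Dr, brl); zmod_cancel. Qed.

Lemma curvB X Y : zmod_morphism (curv D X Y).
Proof. by move=> A B; rewrite /curv !(Dl, Dr); zmod_cancel. Qed.

(** Once [cyclic_nabla] has removed [nabla], the triple products of D cancel as in the Jacobi
    identity for commutators. Only D along the nested brackets is left, which is [J]. *)
Lemma cyclic_bianchi X Y Z x :
  nabla_curv D Z X Y x + nabla_curv D X Y Z x + nabla_curv D Y Z X x = 0.
Proof.
have E1 := @cyclic_nabla (fun X Y => curv D X Y x) (fun X Y => curv_skew X Y x)
  (fun Y => curv_vB Y x) X Y Z.
have J : D (br (br X Y) Z) x + D (br (br Y Z) X) x + D (br (br Z X) Y) x = 0.
  by rewrite -!(Dl x).2 jacobi (Dl x).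
transitivity (D Z (curv D X Y x) - curv D X Y (D Z x) +
 (D X (curv D Y Z x) - curv D Y Z (D X x)) +
 (D Y (curv D Z X x) - curv D Z X (D Y x)) -
 (curv D (br Z X) Y x + curv D (br X Y) Z x + curv D (br Y Z) X x)).
  by rewrite -E1 /nabla_curv; zmod_cancel.
rewrite -[RHS]J /curv !Dr.
zmod_cancel.
Qed.

End Connection.

(* D' stands for D^C. *)
Variables D D' : V -> E -> E.
Hypotheses (Dadd : biadditive D) (D'add : biadditive D').
Variable gam : V -> E -> E.
Hypothesis gamadd : biadditive gam.

Let Dr X := zmod_morphism_simpl (Dadd.1 X).
Let Dl x := zmod_morphism_simpl (Dadd.2 x).
Let D'r X := zmod_morphism_simpl (D'add.1 X).
Let D'l x := zmod_morphism_simpl (D'add.2 x).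
Let gr X := zmod_morphism_simpl (gamadd.1 X).
Let gl x := zmod_morphism_simpl (gamadd.2 x).
Let brl X := zmod_morphism_simpl (brB X).

Definition nabla_gam X Y x := D X (gam Y x) - gam (nabla X Y) x - gam Y (D' X x).

Definition tors X Y x := nabla_gam X Y x - nabla_gam Y X x.

(* This is ad^C_{R(X,Y)} Phi, because the curvature of D^C is - R^C. *)
Definition curv_act (Phi : E -> E) X Y x := curv D X Y (Phi x) - Phi (curv D' X Y x).

(** Here [nabla] survives only through the bracket, so additivity of the torsion in a vector field
    comes from that of [br]. *)
Lemma torsE X Y x : tors X Y x =
  D X (gam Y x) - gam Y (D' X x) - D Y (gam X x) + gam X (D' Y x) - gam (br X Y) x.
Proof. by rewrite /tors /nabla_gam -nabla_br !gl; zmod_cancel. Qed.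

Lemma tors_skew X Y x : tors X Y x = - tors Y X x.
Proof. by rewrite /tors opprB. Qed.

Lemma tors_vB Y x : zmod_morphism (fun X => tors X Y x).
Proof. by move=> A B; rewrite !torsE !(Dl, Dr, D'l, gl, gr, brl); zmod_cancel. Qed.

Definition nabla_tors Z X Y x :=
  D Z (tors X Y x) - (tors (nabla Z X) Y x + tors X (nabla Z Y) x) - tors X Y (D' Z x).

(** The mixed terms D gam D' cancel in the cyclic sum. Second derivatives to the left of gam form
    the curvature of D, those to the right the curvature of D', and gam of the nested brackets
    vanishes by Jacobi. *)
Lemma cyclic_nabla_tors X Y Z x :
  nabla_tors Z X Y x + nabla_tors X Y Z x + nabla_tors Y Z X x =
  curv_act (gam Y) Z X x + curv_act (gam Z) X Y x + curv_act (gam X) Y Z x.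
Proof.
have E1 := @cyclic_nabla (fun X Y => tors X Y x) (fun X Y => tors_skew X Y x)
  (fun Y => tors_vB Y x) X Y Z.
have J : gam (br (br X Y) Z) x + gam (br (br Y Z) X) x + gam (br (br Z X) Y) x = 0.
  by rewrite -!(gl x).2 jacobi (gl x).
transitivity (D Z (tors X Y x) - tors X Y (D' Z x) +
 (D X (tors Y Z x) - tors Y Z (D' X x)) +
 (D Y (tors Z X x) - tors Z X (D' Y x)) -
 (tors (br Z X) Y x + tors (br X Y) Z x + tors (br Y Z) X x)).
  by rewrite -E1 /nabla_tors; zmod_cancel.
rewrite -[RHS]addr0 -[X in _ = _ + X]J /curv_act /curv !torsE !(Dr, gr).
zmod_cancel.
Qed.

Definition nabla_curv_act W X Y Z x :=
  D W (curv_act (gam Z) X Y x) -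
  (curv_act (gam Z) (nabla W X) Y x +
   (curv_act (gam Z) X (nabla W Y) x + curv_act (gam (nabla W Z)) X Y x)) -
  curv_act (gam Z) X Y (D' W x).

(** Leibniz rule: [curv D X Y (D W (gam Z x))] and [gam Z (D' W (curv D' X Y x))] occur on the right
    with both signs. *)
Lemma nabla_curv_actE W X Y Z x : nabla_curv_act W X Y Z x =
  nabla_curv D W X Y (gam Z x) - gam Z (nabla_curv D' W X Y x) +
  curv_act (nabla_gam W Z) X Y x.
Proof.
rewrite /nabla_curv_act /nabla_curv /curv_act /nabla_gam.
have cr A B := zmod_morphism_simpl (curvB Dadd A B).
rewrite !(cr, Dr, gr).
zmod_cancel.
Qed.

End CyclicIdentities.

(** * Derivations and constants on real or complex valued functions *)

Section Scalars.
Variables (R : realType) (n : nat) (M : manifold R n) (k : scalars).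

Lemma srealN1 : sreal k (-1 : C^oo M) = -1.
Proof.
by apply: Csm_ext => p /=; case: k => //=; apply/eqP; rewrite eq_complex /= oppr0 !eqxx.
Qed.

Lemma cmkB (a b c d : R) : cmk R k (a - b) (c - d) = cmk R k a c - cmk R k b d.
Proof. by case: k. Qed.

Lemma vactKB (X : vfield M) : zmod_morphism (@vactK _ _ _ k X).
Proof.
move=> f h.
have E1 : sre (f - h) = sre f - sre h by apply: Csm_ext => p /=; rewrite creD creN.
have E2 : sim (f - h) = sim f - sim h by apply: Csm_ext => p /=; rewrite cimD cimN.
rewrite /vactK E1 E2 !vactD !vactN; apply: Csm_ext => p.
exact: cmkB.
Qed.

Lemma vactK_vB (f : Csm M k) : zmod_morphism (fun X : vfield M => vactK X f).
Proof.
by move=> X Y; apply: Csm_ext => p; rewrite /= !mulN1r; exact: cmkB.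
Qed.

Lemma vactK_smk (X : vfield M) (a b : C^oo M) :
  vactK X (smk k a b) = smk k (X a) (X b).
Proof.
apply: Csm_ext => p; rewrite /vactK /=; case: k => /=.
  by congr (X _ p); exact: Csm_ext.
by congr (Complex (X _ p) (X _ p)); exact: Csm_ext.
Qed.

Lemma vactK_bracket (X Y : vfield M) (f : Csm M k) :
  vactK (vbracket X Y) f = vactK X (vactK Y f) - vactK Y (vactK X f).
Proof.
rewrite [vactK Y f]/vactK [vactK X f]/vactK !vactK_smk.
by apply: Csm_ext => p; exact: cmkB.
Qed.

Lemma ccst_nat j : ccst M (j%:R : coef R k) = j%:R.
Proof.
elim: j => [|j IHj]; first exact: Csm_ext.
by rewrite [RHS]mulrS -IHj; apply: Csm_ext => p /=; rewrite mulrS.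
Qed.

Lemma ccst_natV j : ccst M (j.+1%:R^-1 : coef R k) * j.+1%:R = 1.
Proof.
rewrite -ccst_nat; apply: Csm_ext => p; apply: mulVf.
by case: k; rewrite pnatr_eq0.
Qed.

End Scalars.

(** * The Lie bracket of vector fields *)

Section VectorFields.
Variables (R : realType) (n : nat) (M : manifold R n).

Lemma vbracketBl (X : vfield M) : zmod_morphism ((@vbracket _ _ M)^~ X).
Proof.
move=> Y Z; apply: vfield_ext => f; apply: Csm_ext => p /=.
rewrite !(vactD, mulN1r, vactN) /=.
by rewrite !opprD !opprK addrACA.
Qed.

Lemma vbracket_jacobi (X Y Z : vfield M) :
  vbracket (vbracket X Y) Z + vbracket (vbracket Y Z) X +
  vbracket (vbracket Z X) Y = 0.
Proof.
apply: vfield_ext => f; change (_ = 0) with (_ = (0 : C^oo M)).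
rewrite /= !(vactD, vactN).
zmod_cancel.
Qed.

End VectorFields.

(** * Additivity of connections *)

Section Connections.
Variables (R : realType) (n : nat) (M : manifold R n) (k : scalars) (r : nat).
Variable S : vbundle M k r.

Lemma sreal_linear_zmod (F : vfield M -> Gam S) :
  (forall f X Y, F (f *: X + Y) = sreal k f *: F X + F Y) -> zmod_morphism F.
Proof.
by move=> FL X Y; rewrite addrC -scaleN1r FL srealN1 scaleN1r addrC.
Qed.

Lemma connection_biadditive (D : vfield M -> Gam S -> Gam S) :
  is_connection D -> biadditive D.
Proof.
move=> DP; split=> [X x y|x]; last first.
  by apply: sreal_linear_zmod => f X Y; exact: (conn_linl DP).
have D0 : D X 0 = 0 by apply: (addrI (D X 0)); rewrite -(conn_addr DP) !addr0.
rewrite (conn_addr DP); congr (_ + _); apply: (addrI (D X y)).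
by rewrite -(conn_addr DP) !subrr.
Qed.

End Connections.

(** * The connection D^C as the dual of D with respect to C *)

Section DualConnection.
Variables (R : realType) (n : nat) (M : manifold R n) (k : scalars) (r : nat).
Variable S : vbundle M k r.
Variables (nablaS D : vfield M -> Gam S -> Gam S) (C : Gam S -> Gam S -> Csm M k).
Hypotheses (nablaSP : is_connection nablaS) (DP : is_connection D).
Hypotheses (C_bilinear : form_bilinear C) (C_nondeg : form_nondegenerate C).
Hypothesis C_parallel : forall X eta xi,
  vactK X (C eta xi) = C (nablaS X eta) xi + C eta (nablaS X xi).

Let CBl xi : zmod_morphism (C^~ xi).
Proof.
by move=> x y /=; rewrite addrC -scaleN1r (C_bilinear.2 xi) mulN1r addrC.
Qed.

Let CBr eta : zmod_morphism (C eta).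
Proof.
by move=> x y /=; rewrite addrC -scaleN1r (C_bilinear.1 eta) mulN1r addrC.
Qed.

Lemma form_injl x y : (forall z, C x z = C y z) -> x = y.
Proof.
move=> xy; apply/eqP; rewrite -subr_eq0; apply/eqP; apply: C_nondeg.1 => z.
by rewrite (CBl z) xy subrr.
Qed.

(** Non-degeneracy allows at most one adjoint value, so the choice made by [xget] agrees with any
    witness, and its default 0 does not occur. *)
Lemma cadj_eq (Phi : endo S) eta zeta :
  (forall xi, C zeta xi = C eta (Phi xi)) -> cadj C Phi eta = zeta.
Proof.
move=> zetaP; rewrite /cadj; case: xgetP => [z _ zP|/(_ zeta)//].
by apply: form_injl => xi; rewrite zP zetaP.
Qed.

Lemma connC_dual X eta xi :
  vactK X (C eta xi) = C (connC C nablaS D X eta) xi + C eta (D X xi).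
Proof.
(* The derivatives of the coefficient cancel in D - nablaS, so this difference is linear over
   functions and non-degeneracy provides its adjoint. *)
have A_scalar : scalar (fun xi => C eta (D X xi - nablaS X xi)).
  move=> f x y; rewrite -(C_bilinear.1 eta); congr (C eta).
  rewrite (conn_addr DP) (conn_addr nablaSP) (conn_leibniz DP).
  by rewrite (conn_leibniz nablaSP) scalerBr; zmod_cancel.
have [zeta zetaP] := C_nondeg.2 _ A_scalar.
rewrite /connC (cadj_eq zetaP) (CBl xi) zetaP (CBr eta) C_parallel.
zmod_cancel.
Qed.

Let C_connC X eta xi :
  C (connC C nablaS D X eta) xi = vactK X (C eta xi) - C eta (D X xi).
Proof. by rewrite connC_dual addrK. Qed.

Lemma connC_biadditive : biadditive (connC C nablaS D).
Proof.
split=> [X x y|x X Y]; apply: form_injl => z; rewrite (CBl z) !C_connC.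
  by rewrite !(CBl _) (vactKB X); zmod_cancel.
rewrite (vactK_vB (C x z)) ((connection_biadditive DP).2 z) (CBr x).
zmod_cancel.
Qed.

(** Duality is applied twice to move both derivatives from xi to eta. The second derivatives of the
    function C eta xi then cancel against its derivative along the bracket. *)
Lemma cadj_curvature Xs eta :
  cadj C (curvature D Xs) eta = - curvature (connC C nablaS D) Xs eta.
Proof.
apply: cadj_eq => xi; rewrite /curvature.
have Cr := zmod_morphism_simpl (CBr _); have Cl := zmod_morphism_simpl (CBl _).
rewrite !(Cr, Cl, C_connC) vactK_bracket.
have vr X := zmod_morphism_simpl (@vactKB _ _ _ k X).
rewrite !vr.
zmod_cancel.
Qed.

Lemma adC_curvature Xs (Phi : endo S) xi : zmod_morphism Phi ->
  adC C (curvature D Xs) Phi xi =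
  curvature D Xs (Phi xi) - Phi (curvature (connC C nablaS D) Xs xi).
Proof.
by move=> /zmod_morphism_simpl PhiE; rewrite /adC cadj_curvature PhiE.
Qed.

End DualConnection.

(** * Skew-symmetrization and permutations of the arguments *)

Section Alternation.
Variables (R : realType) (n : nat) (M : manifold R n) (k : scalars) (r m : nat).
Variable S : vbundle M k r.
Implicit Types (F G : etensor S m) (X : 'I_m -> vfield M) (t : 'S_m).

Lemma alt_ext F G X xi : (forall Y, F Y xi = G Y xi) -> alt F X xi = alt G X xi.
Proof. by move=> FG; congr (_ *: _); apply: eq_bigr => s _; rewrite FG. Qed.

Lemma altD F G X xi :
  alt (fun Y xi => F Y xi + G Y xi) X xi = alt F X xi + alt G X xi.
Proof.
rewrite /alt -scalerDr -big_split; congr (_ *: _).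
by apply: eq_bigr => s _; rewrite scalerDr.
Qed.

Lemma altN F X xi : alt (fun Y xi => - F Y xi) X xi = - alt F X xi.
Proof.
rewrite /alt -scalerN -sumrN; congr (_ *: _).
by apply: eq_bigr => s _; rewrite scalerN.
Qed.

Lemma alt_perm t F X xi :
  alt (fun Y => F (fun i => Y (t i))) X xi = (-1) ^+ t *: alt F X xi.
Proof.
rewrite /alt scalerA mulrC -scalerA; congr (_ *: _).
(* The product t * s applies t first, so substituting t * s for s on the right matches the arguments
   Y (t i) with Y = X o s. *)
rewrite scaler_sumr [RHS](reindex_inj (mulgI t)); apply: eq_bigr => s _.
rewrite scalerA odd_permM signr_addb mulrA -expr2 sqrr_sign mul1r.
by congr (_ *: F _ xi); apply/funext => i; rewrite permM.
Qed.

Lemma alt_even_perm t F X xi : ~~ odd_perm t ->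
  alt (fun Y => F (fun i => Y (t i))) X xi = alt F X xi.
Proof. by move=> /negPf t_even; rewrite alt_perm t_even scale1r. Qed.

Lemma alt_odd_perm t F X xi : odd_perm t ->
  alt (fun Y => F (fun i => Y (t i))) X xi = - alt F X xi.
Proof. by move=> t_odd; rewrite alt_perm t_odd scaleN1r. Qed.

(** An even permutation does not change the alternation, so three times [alt F] is the alternation
    of a vanishing sum, and 3 is invertible. *)
Lemma alt_eq0_orbit3 t F X xi : ~~ odd_perm t ->
  (forall Y, F Y xi + F (fun i => Y (t i)) xi + F (fun i => Y (t (t i))) xi = 0) ->
  alt F X xi = 0.
Proof.
move=> t_even F0.
pose Ft : etensor S m := fun Y => F (fun i => Y (t i)).
pose Ftt : etensor S m := fun Y => Ft (fun i => Y (t i)).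
have Ft_alt : alt Ft X xi = alt F X xi by exact: alt_even_perm.
have Ftt_alt : alt Ftt X xi = alt F X xi.
  by rewrite -Ft_alt; exact: (alt_even_perm Ft).
have alt3 : alt F X xi + alt F X xi + alt F X xi = 0.
  rewrite -[X in _ + X + _]Ft_alt -[X in _ + X = _]Ftt_alt -!altD.
  by rewrite /alt big1 ?scaler0 // => s _; rewrite F0 scaler0.
have -> : alt F X xi =
    ccst M (3^-1 : coef R k) *: (alt F X xi + alt F X xi + alt F X xi).
  rewrite -!mulr2n -mulrSr -scaler_nat scalerA -[LHS]scale1r; congr (_ *: _).
  exact/esym/ccst_natV.
by rewrite alt3 scaler0.
Qed.

End Alternation.

(** * The cyclic permutation of the first three arguments *)

Section ThreeCycle.
Variable m : nat.

Let o0 : 'I_m.+3 := ord0.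
Let o1 : 'I_m.+3 := lift ord0 ord0.
Let o2 : 'I_m.+3 := lift ord0 (lift ord0 ord0).

(** The further m indices stay fixed, so that one cycle serves the identities with three indices (m
    = 0) and with four (m = 1). *)
Definition cycle3 : 'S_m.+3 := tperm o1 o2 * tperm o0 o1.

Lemma cycle3E : (cycle3 o0 = o1) * (cycle3 o1 = o2) * (cycle3 o2 = o0) *
  (forall i : 'I_m, cycle3 (rshift 3 i) = rshift 3 i).
Proof. by split=> [|i]; [split; [split|]|]; rewrite permM !permE. Qed.

Lemma cycle3_even : ~~ odd_perm cycle3.
Proof. by rewrite odd_permM !odd_tperm. Qed.

End ThreeCycle.

(** * The three identities on the spinor bundle *)

Section Identities.
Variables (R : realType) (n : nat) (M : manifold R n) (g : metric M).
Variables (nabla : vfield M -> vfield M -> vfield M).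
Hypothesis nablaP : is_levi_civita g nabla.
Variables (k : scalars) (S : spinor_bundle g k).
Variables (nablaS D : vfield M -> Gam S -> Gam S) (C : Gam S -> Gam S -> Csm M k).
Hypotheses (nablaSP : is_spin_connection nabla nablaS).
Hypotheses (CP : is_charge_conjugation nablaS C) (DP : is_connection D).

Let D' := connC C nablaS D.
Let gam : vfield M -> Gam S -> Gam S := cliff S.
Let T := torsion C nabla nablaS D gam.
Let br := @vbracket _ _ M.

Lemma cliff_biadditive : biadditive gam.
Proof.
split=> [X x y|x]; first exact: raddfB.
by apply: sreal_linear_zmod => f X Y; exact: cliff_linl.
Qed.

Let nabla_br := lc_torsion_free nablaP.

Let Dadd := connection_biadditive DP.

Let D'add : biadditive D'.
Proof.
exact: (connC_biadditive (spin_conn nablaSP) DP (cc_bilinear CP) (cc_nondeg CP)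
  (cc_parallel CP)).
Qed.

Let adC_curv Xs Phi xi : zmod_morphism Phi ->
  adC C (curvature D Xs) Phi xi = curv_act br D D' Phi (Xs ord0) (Xs ord_max) xi.
Proof.
exact: (adC_curvature (spin_conn nablaSP) DP (cc_bilinear CP) (cc_nondeg CP)
  (cc_parallel CP)).
Qed.

Lemma torsionE Xs xi : T Xs xi = tors nabla D D' gam (Xs ord0) (Xs ord_max) xi.
Proof. by rewrite /T /torsion /hatD /leibniz_sum !big_ord1. Qed.

(** Additivity in the spinor is what [adC_curv] asks of the torsion in [adCR_torsionE]. *)
Lemma tors_zmod X Y : zmod_morphism (tors nabla D D' gam X Y).
Proof.
move=> x y; rewrite !(torsE nabla_br D D' cliff_biadditive).
have Dr X := zmod_morphism_simpl (Dadd.1 X).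
have D'r X := zmod_morphism_simpl (D'add.1 X).
have gr X := zmod_morphism_simpl (cliff_biadditive.1 X).
rewrite !(Dr, D'r, gr).
zmod_cancel.
Qed.

Lemma hatD_torsionE Xs xi :
  uncurry_tensor (fun Z => hatD C nabla nablaS D Z T) Xs xi =
  nabla_tors nabla D D' gam (Xs ord0) (Xs (lift ord0 ord0))
    (Xs (lift ord0 (lift ord0 ord0))) xi.
Proof.
rewrite /uncurry_tensor /hatD /leibniz_sum !big_ord_recl big_ord0 addr0 !torsionE.
by have -> : ord_max = lift ord0 ord0 :> 'I_2 by exact: val_inj.
Qed.

Lemma adCR_gammaE Xs xi :
  adCR C D (gam_tensor gam) Xs xi =
  curv_act br D D' (gam (Xs (lift ord0 (lift ord0 ord0))))
    (Xs ord0) (Xs (lift ord0 ord0)) xi.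
Proof.
rewrite /adCR adC_curv; last exact: cliff_biadditive.1.
rewrite /gam_tensor; congr (curv_act br D D' (gam (Xs _)) (Xs _) (Xs _) _);
  exact: val_inj.
Qed.

Lemma adCR_torsionE Xs xi :
  adCR C D T Xs xi =
  curv_act br D D'
    (tors nabla D D' gam (Xs (lift ord0 (lift ord0 ord0)))
      (Xs (lift ord0 (lift ord0 (lift ord0 ord0)))))
    (Xs ord0) (Xs (lift ord0 ord0)) xi.
Proof.
have T_zmod Ys : zmod_morphism (T Ys).
  by move=> x y; rewrite !torsionE tors_zmod.
rewrite /adCR adC_curv // /curv_act !torsionE.
by congr (curv _ _ (Xs _) (Xs _) (tors _ _ _ _ (Xs _) (Xs _) _) -
   tors _ _ _ _ (Xs _) (Xs _) (curv _ _ (Xs _) (Xs _) _));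
  exact: val_inj.
Qed.

Lemma hatD_adCR_gammaE Xs xi :
  uncurry_tensor (fun Z => hatD C nabla nablaS D Z (adCR C D (gam_tensor gam))) Xs xi =
  nabla_curv_act br nabla D D' gam (Xs ord0) (Xs (lift ord0 ord0))
    (Xs (lift ord0 (lift ord0 ord0)))
    (Xs (lift ord0 (lift ord0 (lift ord0 ord0)))) xi.
Proof.
rewrite /uncurry_tensor /hatD /leibniz_sum !big_ord_recl big_ord0 addr0.
by rewrite !adCR_gammaE.
Qed.

Lemma covD_curvatureE Xs xi :
  uncurry_tensor (fun Z => covD nabla D Z (curvature D)) Xs xi =
  nabla_curv br nabla D (Xs ord0) (Xs (lift ord0 ord0))
    (Xs (lift ord0 (lift ord0 ord0))) xi.
Proof.
rewrite /uncurry_tensor /covD /leibniz_sum !big_ord_recl big_ord0 addr0.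
rewrite /curvature.
by have -> : ord_max = lift ord0 ord0 :> 'I_2 by exact: val_inj.
Qed.

Let brB := @vbracketBl _ _ M.
Let jacobi := @vbracket_jacobi _ _ M.

Lemma alt_hatD_torsion X xi :
  alt (uncurry_tensor (fun Z => hatD C nabla nablaS D Z T)) X xi =
  alt (adCR C D (gam_tensor gam)) X xi.
Proof.
apply/eqP; rewrite -subr_eq0 -altN -altD; apply/eqP.
apply: (alt_eq0_orbit3 _ (cycle3_even 0)) => Y.
rewrite !hatD_torsionE !adCR_gammaE !cycle3E.
set x := Y _; set y := Y _; set z := Y _.
have cyc := cyclic_nabla_tors nabla_br brB jacobi Dadd D'add cliff_biadditive y z x xi.
(* The positive and the negative terms are collected into the two cyclic sums equated by [cyc]. *)
by rewrite [X in X + _]addrACA -opprD addrACA -opprD cyc subrr.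
Qed.

Lemma alt_covD_curvature X xi :
  alt (uncurry_tensor (fun Z => covD nabla D Z (curvature D))) X xi = 0.
Proof.
apply: (alt_eq0_orbit3 _ (cycle3_even 0)) => Y; rewrite !covD_curvatureE !cycle3E.
exact: (cyclic_bianchi nabla_br).
Qed.

Lemma alt_hatD_adCR_gamma X xi :
  alt (uncurry_tensor (fun Z => hatD C nabla nablaS D Z (adCR C D (gam_tensor gam))))
    X xi =
  ccst M (2^-1 : coef R k) *: alt (adCR C D T) X xi.
Proof.
pose o0 : 'I_4 := ord0; pose o1 : 'I_4 := lift ord0 ord0.
(* The form [rshift 3 ord0] of the last index is the one that [cycle3E] recognizes as fixed. *)
pose o2 : 'I_4 := lift ord0 (lift ord0 ord0); pose o3 : 'I_4 := rshift 3 ord0.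
have o3E : lift ord0 (lift ord0 (lift ord0 ord0)) = o3 by exact: val_inj.
(* [B] collects the derivatives of the two curvatures. [P] is ad^C_R applied to hat D gamma, with
   the arguments ordered as in ad^C_R T. *)
pose B : etensor S 4 := fun Y x =>
  nabla_curv br nabla D (Y o0) (Y o1) (Y o2) (gam (Y o3) x) -
  gam (Y o3) (nabla_curv br nabla D' (Y o0) (Y o1) (Y o2) x).
pose P : etensor S 4 := fun Y =>
  curv_act br D D' (nabla_gam nabla D D' gam (Y o2) (Y o3)) (Y o0) (Y o1).
(* With the argument of gamma fixed, the cyclic sum over the other three vanishes by the Bianchi
   identities of D and D'. *)
have B0 : alt B X xi = 0.
  apply: (alt_eq0_orbit3 _ (cycle3_even 1)) => Y; rewrite /B !cycle3E.
  set x := Y _; set y := Y _; set z := Y _; set w := Y _.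
  rewrite [X in X + _]addrACA -opprD addrACA -opprD (cyclic_bianchi nabla_br) //.
  rewrite -!(zmod_morphism_simpl (cliff_biadditive.1 w)).2.
  rewrite (cyclic_bianchi nabla_br) //.
  by rewrite (zmod_morphism_simpl (cliff_biadditive.1 w)) subrr.
have -> : alt (uncurry_tensor
    (fun Z => hatD C nabla nablaS D Z (adCR C D (gam_tensor gam)))) X xi =
    alt P X xi.
  (* The Leibniz rule differentiates gamma along the first argument, [P] along the third; the even
     cycle carries one order to the other. *)
  rewrite -(alt_even_perm P _ _ (cycle3_even 1)) -[RHS]add0r -B0 -altD.
  apply: alt_ext => Y; rewrite hatD_adCR_gammaE nabla_curv_actE //; last first.
    exact: cliff_biadditive.
  by rewrite /P !cycle3E o3E.
have -> : alt (adCR C D T) X xi = alt P X xi + alt P X xi.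
  (* The torsion is a difference of two terms exchanged by this transposition. The odd sign makes
     both contribute [alt P], which explains the factor 1/2. *)
  have t_odd : odd_perm (tperm o2 o3) by rewrite odd_tperm.
  rewrite -[X in _ + X]opprK -(alt_odd_perm P _ _ t_odd) -altN -altD.
  apply: alt_ext => Y; rewrite adCR_torsionE o3E /P tpermL tpermR !tpermD //.
  rewrite /curv_act /tors (curvB _ Dadd); zmod_cancel.
by rewrite -mulr2n -scaler_nat scalerA ccst_natV scale1r.
Qed.

End Identities.

Theorem proposition4 (R : realType) (n : nat) (M : manifold R n) (g : metric M)
    (nabla : vfield M -> vfield M -> vfield M) (nablaP : is_levi_civita g nabla)
    (k : scalars) (S : spinor_bundle g k)
    (nablaS : vfield M -> Gam S -> Gam S) (nablaSP : is_spin_connection nabla nablaS)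
    (C : Gam S -> Gam S -> Csm M k) (CP : is_charge_conjugation nablaS C)
    (D : vfield M -> Gam S -> Gam S) (DP : is_connection D) :
  let gamma := gam_tensor (cliff S) in
  let T := torsion C nabla nablaS D (cliff S) in
  let Rc := curvature D in
  let hD := fun (m : nat) (Phi : etensor S m) =>
    uncurry_tensor (fun Z => hatD C nabla nablaS D Z Phi) in
  [/\ (forall (X : 'I_3 -> vfield M) (xi : Gam S),
         alt (hD 2%N T) X xi = alt (adCR C D gamma) X xi),
      (forall (X : 'I_4 -> vfield M) (xi : Gam S),
         alt (hD 3%N (adCR C D gamma)) X xi =
         ccst M (2^-1 : coef R k) *: alt (adCR C D T) X xi) &
      (forall (X : 'I_3 -> vfield M) (xi : Gam S),
         alt (uncurry_tensor (fun Z => covD nabla D Z Rc)) X xi = 0)].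
Proof.
split; [exact: (alt_hatD_torsion nablaP nablaSP CP DP)
  |exact: (alt_hatD_adCR_gamma nablaP nablaSP CP DP)
  |exact: (alt_covD_curvature nablaP DP)].
Qed.
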